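(* The problem $$(\mathrm D_h)\qquad\min_{\boldsymbol\lambda,{\bf p},\boldsymbol\mu\in\mathbb R^{N_h}}\ \Phi_h(\boldsymbol\lambda,{\bf p},\boldsymbol\mu):=\tfrac12\|K_h{\bf p}-M_h{\bf y_d}\|_{M_h^{-1}}^2+\tfrac1{2\alpha}\|\boldsymbol\lambda+\boldsymbol\mu-{\bf p}\|_{M_h}^2+\langle M_h{\bf y_r},{\bf p}\rangle+\delta_{[-\beta,\beta]}(\boldsymbol\lambda)+\delta^*_{[a,b]}(M_h\boldsymbol\mu)-\tfrac12\|{\bf y_d}\|_{M_h}^2$$ is (in equivalent minimization form) the dual problem of $$\min_{{\bf y},{\bf u}}\ \tfrac12\|{\bf y}-{\bf y_d}\|_{M_h}^2+\tfrac\alpha2\|{\bf u}\|_{M_h}^2+\beta\|M_h{\bf u}\|_1\quad\text{s.t.}\quad K_h{\bf y}=M_h({\bf u}+{\bf y_r}),\ \ {\bf u}\in[a,b]^{N_h};$$ in other words, the latter problem is the primal problem of $(\mathrm D_h)$.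
   Context: $\alpha,\beta>0$ and $a\le0\le b$ are real constants, and ${\bf y_d},{\bf y_r}\in\mathbb R^{N_h}$ are given vectors (coefficient vectors of the $L^2$-projections of functions $y_d,y_r\in L^2(\Omega)$ onto a piecewise linear finite element space with nodal basis $\{\phi_i\}_{i=1}^{N_h}$). $M_h=(\int_{\Omega_h}\phi_i\phi_j\,\mathrm dx)_{i,j}$ is the mass matrix and $K_h=(a(\phi_i,\phi_j))_{i,j}$ the stiffness matrix of a symmetric, coercive bilinear form $a(\cdot,\cdot)$ on $H_0^1(\Omega)$; both are symmetric positive definite. For a symmetric positive definite matrix $Q$, $\|{\bf x}\|_Q^2={\bf x}^TQ{\bf x}$; $\langle\cdot,\cdot\rangle$ is the Euclidean inner product and $\|\cdot\|_1$ the $\ell^1$-norm. $\delta_{[-\beta,\beta]}$ and $\delta_{[a,b]}$ denote the indicator functions ($0$ on the set, $+\infty$ outside) of the boxes $[-\beta,\beta]^{N_h}$ and $[a,b]^{N_h}$, and $\delta^*_{[a,b]}({\bf w})=\sup_{{\bf v}\in[a,b]^{N_h}}\langle{\bf w},{\bf v}\rangle$. ''Dual problem'' means the Lagrangian dual of the second problem after the splitting ${\bf v}={\bf u}$, ${\bf w}={\bf u}$: with $$\mathcal L({\bf y},{\bf u},{\bf v},{\bf w};{\bf p},\boldsymbol\lambda,\boldsymbol\mu)=\tfrac12\|{\bf y}-{\bf y_d}\|_{M_h}^2+\tfrac\alpha2\|{\bf u}\|_{M_h}^2+\beta\|M_h{\bf v}\|_1+\delta_{[a,b]}({\bf w})+\langle{\bf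 p},K_h{\bf y}-M_h({\bf u}+{\bf y_r})\rangle+\langle\boldsymbol\lambda,M_h({\bf u}-{\bf v})\rangle+\langle\boldsymbol\mu,M_h({\bf u}-{\bf w})\rangle,$$ the dual problem is $\max_{{\bf p},\boldsymbol\lambda,\boldsymbol\mu}\inf_{{\bf y},{\bf u},{\bf v},{\bf w}}\mathcal L$, and its equivalent minimization form is the minimization of $-\inf_{{\bf y},{\bf u},{\bf v},{\bf w}}\mathcal L$ over $({\bf p},\boldsymbol\lambda,\boldsymbol\mu)$. *)

(* Defs.v *)
From HB Require Import structures.
From mathcomp Require Import all_boot all_order all_algebra.
From mathcomp Require Import all_classical all_reals all_analysis.
Set Implicit Arguments.
Unset Strict Implicit.
Unset Printing Implicit Defensive.
Import Order.TTheory GRing.Theory Num.Theory.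
Local Open Scope classical_set_scope.
Local Open Scope ring_scope.

Definition spd (R : realType) (N : nat) (Q : 'M[R]_N) : Prop :=
  Q^T = Q /\ forall x : 'cV[R]_N, x != 0 -> 0 < (x^T *m Q *m x) 0 0.

Definition inner (R : realType) (N : nat) (x z : 'cV[R]_N) : R :=
  \sum_(i < N) x i 0 * z i 0.

Definition sqnorm (R : realType) (N : nat) (Q : 'M[R]_N) (x : 'cV[R]_N) : R :=
  (x^T *m Q *m x) 0 0.

Definition norm1 (R : realType) (N : nat) (x : 'cV[R]_N) : R :=
  \sum_(i < N) `|x i 0|.

Definition box (R : realType) (N : nat) (l r : R) : set 'cV[R]_N :=
  [set x | forall i, l <= x i 0 <= r].

Definition indicator (R : realType) (N : nat) (A : set 'cV[R]_N)
    (x : 'cV[R]_N) : \bar R :=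
  if `[< A x >] then 0%E else +oo%E.

Definition support_fun (R : realType) (N : nat) (A : set 'cV[R]_N)
    (w : 'cV[R]_N) : \bar R :=
  ereal_sup [set (inner w v)%:E | v in A].

(* A constrained minimization problem is encoded by its extended-valued
   objective, equal to +oo at the infeasible points. *)
Definition primal_obj (R : realType) (N : nat) (alpha beta a b : R)
    (M K : 'M[R]_N) (yd yr : 'cV[R]_N) (y u : 'cV[R]_N) : \bar R :=
  if `[< K *m y = M *m (u + yr) /\ box a b u >] then
    (2^-1 * sqnorm M (y - yd) + alpha / 2 * sqnorm M u
     + beta * norm1 (M *m u))%:E
  else +oo%E.

Definition split_obj (R : realType) (N : nat) (alpha beta a b : R)
    (M K : 'M[R]_N) (yd yr : 'cV[R]_N) (y u v w : 'cV[R]_N) : \bar R :=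
  if `[< [/\ K *m y = M *m (u + yr), v = u & w = u] >] then
    ((2^-1 * sqnorm M (y - yd) + alpha / 2 * sqnorm M u
      + beta * norm1 (M *m v))%:E
     + indicator (box a b) w)%E
  else +oo%E.

Definition lagrangian (R : realType) (N : nat) (alpha beta a b : R)
    (M K : 'M[R]_N) (yd yr : 'cV[R]_N)
    (y u v w p lam mu : 'cV[R]_N) : \bar R :=
  ((2^-1 * sqnorm M (y - yd) + alpha / 2 * sqnorm M u
    + beta * norm1 (M *m v))%:E
   + indicator (box a b) w
   + (inner p (K *m y - M *m (u + yr))
      + inner lam (M *m (u - v)) + inner mu (M *m (u - w)))%:E)%E.

Definition dual_fun (R : realType) (N : nat) (alpha beta a b : R)
    (M K : 'M[R]_N) (yd yr : 'cV[R]_N) (p lam mu : 'cV[R]_N) : \bar R :=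
  ereal_inf [set l | exists y u v w : 'cV[R]_N,
    l = lagrangian alpha beta a b M K yd yr y u v w p lam mu].

Definition Phi (R : realType) (N : nat) (alpha beta a b : R)
    (M K : 'M[R]_N) (yd yr : 'cV[R]_N) (lam p mu : 'cV[R]_N) : \bar R :=
  ((2^-1 * sqnorm (invmx M) (K *m p - M *m yd)
    + (2 * alpha)^-1 * sqnorm M (lam + mu - p)
    + inner (M *m yr) p)%:E
   + indicator (box (- beta) beta) lam
   + support_fun (box a b) (M *m mu)
   - (2^-1 * sqnorm M yd)%:E)%E.

(* Main.v *)
Require Import Defs.
From HB Require Import structures.
From mathcomp Require Import all_boot all_order all_algebra.
From mathcomp Require Import all_classical all_reals all_analysis.
From mathcomp Require Import ring lra.
Set Implicit Arguments.
Unset Strict Implicit.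
Unset Printing Implicit Defensive.
Import Order.TTheory GRing.Theory Num.Theory.
Local Open Scope classical_set_scope.
Local Open Scope ring_scope.

(** Primal side: for fixed (y, u, v, w) with w in the box [a, b]^N, the
    Lagrangian is affine in the multipliers, with the residuals of the three
    constraints as slopes; for w off the box it is +oo throughout.  If all
    residuals vanish it is constant, equal to the split objective; otherwise
    multipliers proportional to the residuals drive it to +oo.  Since M is
    invertible, M(u - v) = 0 forces v = u, so the weighting of the splitting
    constraints by M does not enlarge the feasible set
    ([ereal_sup_lagrangian]).

    Dual side: the Lagrangian separates in y, u, v and w once squares are
    completed ([lagrangian_squares]).  The y-part and the u-part are
    nonnegative squares in the M-norm plus constants, which are the quadratic
    terms of Phi.  The v-part is beta |z|_1 - <lam, z> with z = M v; as M is
    onto, its infimum is minus the conjugate of beta |.|_1 at lam, that is 0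
    if lam is in [-beta, beta]^N ([inner_le_norm1]) and -oo otherwise, because
    a violated coordinate gives a negative value ([inner_gt_norm1]) and the
    expression is positively homogeneous.  The w-part ranges over the box
    [a, b]^N and gives the support function of the box at M mu.  The four
    parts can be optimized independently ([dual_fun_conjugate]). *)

(** * The Euclidean pairing and the norm induced by a matrix *)

Lemma innerC (R : realType) (N : nat) (x z : 'cV[R]_N) : inner x z = inner z x.
Proof. by apply: eq_bigr => i _; rewrite mulrC. Qed.

Lemma innerDr (R : realType) (N : nat) (x z t : 'cV[R]_N) :
  inner x (z + t) = inner x z + inner x t.
Proof.
by rewrite /inner -big_split; apply: eq_bigr => i _; rewrite mxE mulrDr.
Qed.

Lemma innerZr (R : realType) (N : nat) (c : R) (x z : 'cV[R]_N) :
  inner x (c *: z) = c * inner x z.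
Proof.
by rewrite /inner mulr_sumr; apply: eq_bigr => i _; rewrite mxE mulrCA.
Qed.

Lemma innerBr (R : realType) (N : nat) (x z t : 'cV[R]_N) :
  inner x (z - t) = inner x z - inner x t.
Proof. by rewrite innerDr -scaleN1r innerZr mulN1r. Qed.

Lemma innerDl (R : realType) (N : nat) (x z t : 'cV[R]_N) :
  inner (x + z) t = inner x t + inner z t.
Proof. by rewrite innerC innerDr !(innerC t). Qed.

Lemma innerZl (R : realType) (N : nat) (c : R) (x z : 'cV[R]_N) :
  inner (c *: x) z = c * inner x z.
Proof. by rewrite innerC innerZr innerC. Qed.

Lemma innerBl (R : realType) (N : nat) (x z t : 'cV[R]_N) :
  inner (x - z) t = inner x t - inner z t.
Proof. by rewrite innerC innerBr !(innerC t). Qed.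

Lemma inner0r (R : realType) (N : nat) (x : 'cV[R]_N) : inner x 0 = 0.
Proof. by rewrite /inner big1 // => i _; rewrite mxE mulr0. Qed.

Lemma inner_ge0 (R : realType) (N : nat) (x : 'cV[R]_N) : 0 <= inner x x.
Proof. by apply: sumr_ge0 => i _; rewrite -expr2 sqr_ge0. Qed.

Lemma inner_eq0 (R : realType) (N : nat) (x : 'cV[R]_N) :
  inner x x = 0 -> x = 0.
Proof.
move=> x0; apply/colP => i; rewrite mxE.
have sq_ge0 (j : 'I_N) : true -> 0 <= x j 0 * x j 0.
  by move=> _; rewrite -expr2 sqr_ge0.
have /eqP := @psumr_eq0P _ _ predT _ sq_ge0 x0 i isT.
by rewrite mulf_eq0 orbb => /eqP.
Qed.

Lemma inner_delta (R : realType) (N : nat) (x : 'cV[R]_N) (i : 'I_N) :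
  inner x (delta_mx i 0) = x i 0.
Proof.
rewrite /inner (bigD1 i) //= mxE !eqxx mulr1 big1 ?addr0 // => j ji.
by rewrite mxE (negbTE ji) mulr0.
Qed.

Lemma inner_mulmx (R : realType) (N : nat) (x z : 'cV[R]_N) :
  inner x z = (x^T *m z) 0 0.
Proof. by rewrite mxE; apply: eq_bigr => i _; rewrite mxE. Qed.

Lemma inner_adjoint (R : realType) (N : nat) (A : 'M[R]_N) (x z : 'cV[R]_N) :
  A^T = A -> inner x (A *m z) = inner (A *m x) z.
Proof. by move=> symA; rewrite !inner_mulmx trmx_mul symA mulmxA. Qed.

Lemma sqnormE (R : realType) (N : nat) (Q : 'M[R]_N) (x : 'cV[R]_N) :
  sqnorm Q x = inner x (Q *m x).
Proof. by rewrite inner_mulmx mulmxA. Qed.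

Lemma sqnorm_ge0 (R : realType) (N : nat) (Q : 'M[R]_N) (x : 'cV[R]_N) :
  spd Q -> 0 <= sqnorm Q x.
Proof.
move=> [_ posQ]; have [->|/posQ/ltW //] := eqVneq x 0.
by rewrite /sqnorm mulmx0 mxE.
Qed.

Lemma sqnormB (R : realType) (N : nat) (Q : 'M[R]_N) (x z : 'cV[R]_N) :
  Q^T = Q ->
  sqnorm Q (x - z) = sqnorm Q x - 2 * inner x (Q *m z) + sqnorm Q z.
Proof.
move=> symQ; rewrite !sqnormE mulmxBr !innerBr !innerBl.
by rewrite (inner_adjoint z x symQ) (innerC _ x); ring.
Qed.

(** Row-freeness is tested on row vectors v with v Q = 0, for which
    v Q v^T = 0 contradicts positivity unless v = 0. *)
Lemma spd_unitmx (R : realType) (N : nat) (Q : 'M[R]_N) :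
  spd Q -> Q \in unitmx.
Proof.
move=> [symQ posQ]; rewrite -row_free_unit; apply: inj_row_free => v vQ0.
apply/eqP; rewrite -trmx_eq0; apply/negPn/negP => /posQ.
by rewrite trmxK vQ0 mul0mx mxE ltxx.
Qed.

(** The dual quadratic term in the norm of the inverse mass matrix is an
    M-norm after the substitution K p = M q. *)
Lemma sqnorm_invmx (R : realType) (N : nat) (Q : 'M[R]_N) (x : 'cV[R]_N) :
  spd Q -> sqnorm (invmx Q) (Q *m x) = sqnorm Q x.
Proof.
by move=> Qspd; rewrite !sqnormE mulKmx ?spd_unitmx // innerC.
Qed.

(** The linear term is paired through Q, so that the minimizer
    x = - c^-1 q does not involve the inverse of Q. *)
Lemma complete_square (R : realType) (N : nat) (Q : 'M[R]_N) (c : R)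
    (x q : 'cV[R]_N) : Q^T = Q -> c != 0 ->
  c / 2 * sqnorm Q x + inner q (Q *m x)
  = c / 2 * sqnorm Q (x + c^-1 *: q) - (2 * c)^-1 * sqnorm Q q.
Proof.
move=> symQ c0; rewrite !sqnormE mulmxDr -scalemxAr.
rewrite !(innerDr, innerDl, innerZr, innerZl).
by rewrite (inner_adjoint x q symQ) (innerC _ q); field.
Qed.

(** * The l1 norm and its conjugate, the indicator of a box *)

Lemma norm1Z (R : realType) (N : nat) (c : R) (x : 'cV[R]_N) :
  norm1 (c *: x) = `|c| * norm1 x.
Proof.
by rewrite /norm1 mulr_sumr; apply: eq_bigr => i _; rewrite mxE normrM.
Qed.

Lemma norm1_delta (R : realType) (N : nat) (i : 'I_N) :
  norm1 (delta_mx i 0 : 'cV[R]_N) = 1.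
Proof.
rewrite /norm1 (bigD1 i) //= mxE !eqxx normr1 big1 ?addr0 // => j ji.
by rewrite mxE (negbTE ji) normr0.
Qed.

(** Hoelder's inequality for the pair (l-infinity, l1); it makes the conjugate
    of beta |.|_1 vanish on the box. *)
Lemma inner_le_norm1 (R : realType) (N : nat) (beta : R) (x z : 'cV[R]_N) :
  box (- beta) beta x -> inner x z <= beta * norm1 z.
Proof.
move=> boxx; rewrite /inner /norm1 mulr_sumr; apply: ler_sum => i _.
apply: le_trans (ler_norm _) _; rewrite normrM ler_wpM2r //.
by rewrite ler_norml; exact: boxx.
Qed.

(** Off the box the conjugate of beta |.|_1 is positive: a coordinate of
    modulus larger than beta is detected by a signed basis vector. *)
Lemma inner_gt_norm1 (R : realType) (N : nat) (beta : R) (x : 'cV[R]_N) :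
  ~ box (- beta) beta x -> exists z, beta * norm1 z < inner x z.
Proof.
move=> /existsNP[i /negP]; rewrite -ler_norml -ltNge => beta_lt.
exists ((-1) ^+ (x i 0 < 0)%R *: delta_mx i 0).
by rewrite norm1Z norm1_delta innerZr inner_delta normr_sign !mulr1 -normrEsign.
Qed.

(** * Suprema of sets of extended reals *)

(** The form in which unboundedness arises on both sides: along a ray of
    multipliers, and along a ray of primal variables v. *)
Lemma ereal_sup_ray (R : realType) (S : set (\bar R)) (c d : R) :
  0 < d -> (forall t : R, 0 <= t -> S (c + t * d)%:E) -> ereal_sup S = +oo%E.
Proof.
move=> d0 ray; apply/eqyP => A A0.
have t0 : 0 <= (A + `|c|) / d by rewrite divr_ge0 ?addr_ge0 // ltW.
apply: le_trans (ereal_sup_ubound (ray _ t0)).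
rewrite lee_fin divfK ?gt_eqF //.
by have := ler_norm (- c); rewrite normrN; lra.
Qed.

Lemma support_fun_ge0 (R : realType) (N : nat) (A : set 'cV[R]_N)
    (w : 'cV[R]_N) : A 0 -> (0 <= support_fun A w)%E.
Proof.
by move=> A0; apply: ereal_sup_ubound; exists 0 => //; rewrite inner0r.
Qed.

Lemma indicator_in (R : realType) (N : nat) (A : set 'cV[R]_N) (x : 'cV[R]_N) :
  A x -> indicator A x = 0%E.
Proof. by move=> Ax; rewrite /indicator asboolT. Qed.

Lemma indicator_notin (R : realType) (N : nat) (A : set 'cV[R]_N)
    (x : 'cV[R]_N) : ~ A x -> indicator A x = +oo%E.
Proof. by move=> nAx; rewrite /indicator asboolF. Qed.

(** * The two sides of the Lagrangian *)

(** Taking the supremum over the multipliers turns the three equality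
    constraints into exact penalties. *)
Lemma ereal_sup_lagrangian (R : realType) (N : nat) (alpha beta a b : R)
    (M K : 'M[R]_N) (yd yr y u v w : 'cV[R]_N) : spd M ->
  ereal_sup [set l | exists p lam mu : 'cV[R]_N,
    l = lagrangian alpha beta a b M K yd yr y u v w p lam mu]
  = split_obj alpha beta a b M K yd yr y u v w.
Proof.
move=> M_spd; rewrite /split_obj /lagrangian.
set obj : R := 2^-1 * _ + _ + _.
have [boxw|nboxw] := pselect (box a b w); last first.
  rewrite (indicator_notin nboxw) addey // if_same.
  by apply: ereal_supy; exists 0, 0, 0.
rewrite (indicator_in boxw) adde0.
have [[Ky vu wu]|infeasible] :=
  pselect [/\ K *m y = M *m (u + yr), v = u & w = u].
  rewrite asboolT //.
  have Sconst p lam mu : (obj%:E + (inner p (K *m y - M *m (u + yr))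
      + inner lam (M *m (u - v)) + inner mu (M *m (u - w)))%:E = obj%:E)%E.
    by rewrite Ky vu wu !subrr mulmx0 !inner0r -EFinD !addr0.
  rewrite -[RHS]ereal_sup1; congr ereal_sup.
  apply/seteqP; split => [_ [p [lam [mu ->]]]|_ ->] //=.
  by exists 0, 0, 0; rewrite Sconst.
rewrite asboolF //.
set r1 := K *m y - M *m (u + yr); set r2 := M *m (u - v).
set r3 := M *m (u - w).
(* Multipliers t r1, t r2, t r3 give slope |r1|^2 + |r2|^2 + |r3|^2 in t. *)
apply: (@ereal_sup_ray _ _ obj (inner r1 r1 + inner r2 r2 + inner r3 r3)).
  rewrite lt_def !addr_ge0 ?inner_ge0 // andbT; apply/negP => /eqP res0.
  have := inner_ge0 r1; have := inner_ge0 r2; have := inner_ge0 r3.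
  move=> r3ge r2ge r1ge.
  have Minj x : M *m x = 0 -> x = 0.
    by move=> Mx0; rewrite -[x](mulKmx (spd_unitmx M_spd)) Mx0 mulmx0.
  apply: infeasible; split.
  - by apply/subr0_eq/inner_eq0; lra.
  - by apply/esym/subr0_eq/Minj/inner_eq0; lra.
  - by apply/esym/subr0_eq/Minj/inner_eq0; lra.
move=> t _; exists (t *: r1), (t *: r2), (t *: r3).
by rewrite !innerZl -EFinD !mulrDr.
Qed.

(** Separates the four primal variables.  The multiplier p acts on y through
    <p, K y> = <q, M y> with q = M^-1 K p, so completing the square in y - yd
    shifts yd by q; on u the multipliers act through lam + mu - p.  The last
    parenthesis is the real part of Phi. *)
Lemma lagrangian_squares (R : realType) (N : nat) (alpha beta : R)
    (M K : 'M[R]_N) (yd yr y u v w p lam mu : 'cV[R]_N) :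
  alpha != 0 -> spd M -> K^T = K ->
  2^-1 * sqnorm M (y - yd) + alpha / 2 * sqnorm M u + beta * norm1 (M *m v)
  + (inner p (K *m y - M *m (u + yr))
     + inner lam (M *m (u - v)) + inner mu (M *m (u - w)))
  = 2^-1 * sqnorm M (y - (yd - invmx M *m (K *m p)))
    + alpha / 2 * sqnorm M (u + alpha^-1 *: (lam + mu - p))
    + (beta * norm1 (M *m v) - inner lam (M *m v))
    - inner (M *m mu) w
    - (2^-1 * sqnorm (invmx M) (K *m p - M *m yd)
       + (2 * alpha)^-1 * sqnorm M (lam + mu - p)
       + inner (M *m yr) p - 2^-1 * sqnorm M yd).
Proof.
move=> alpha0 M_spd symK; have symM := M_spd.1.
set q := invmx M *m (K *m p).
have Kp : K *m p = M *m q by rewrite mulKVmx ?spd_unitmx.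
(* The y-square leaves -|q|^2/2 + <q, M yd>, which is
   -|q - yd|^2/2 + |yd|^2/2: this is the origin of the |yd|^2 term of Phi. *)
have yE := complete_square (y - yd) q symM (oner_neq0 R).
have uE := complete_square u (lam + mu - p) symM alpha0.
rewrite [_ - yd + _]addrAC invr1 scale1r mul1r mulr1 in yE.
have pKy : inner p (K *m y) = inner q (M *m y).
  by rewrite inner_adjoint // Kp -inner_adjoint.
have -> : y - (yd - q) = y + q - yd by rewrite opprB addrA.
rewrite innerBr pKy Kp -mulmxBr sqnorm_invmx // (sqnormB q yd symM).
rewrite -(inner_adjoint mu w symM) (innerC (M *m yr)).
move: yE uE; rewrite !(mulmxBr, mulmxDr) !(innerBr, innerDr, innerBl, innerDl).
lra.
Qed.

(** After negation the infimum becomes a supremum of values in which y and u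
    only contribute nonpositive squares.  The box [a, b]^N contains 0, hence
    its support function is nonnegative; in particular it is not -oo, and
    the value of Phi at lam outside [-beta, beta]^N is really +oo. *)
Lemma dual_fun_conjugate (R : realType) (N : nat) (alpha beta a b : R)
    (M K : 'M[R]_N) (yd yr lam p mu : 'cV[R]_N) :
  0 < alpha -> a <= 0 -> 0 <= b -> spd M -> K^T = K ->
  (- dual_fun alpha beta a b M K yd yr p lam mu)%E
  = Phi alpha beta a b M K yd yr lam p mu.
Proof.
move=> alpha0 a0 b0 M_spd symK; rewrite /dual_fun -ereal_supN /Phi.
set obj : R := 2^-1 * _ + _ + _.
set S := [set - x | x in _]%E.
pose q := invmx M *m (K *m p).
have box0 : box a b (0 : 'cV[R]_N) by move=> i; rewrite mxE a0 b0.
have M_unit := spd_unitmx M_spd.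
have valE y u v w : box a b w ->
    (- lagrangian alpha beta a b M K yd yr y u v w p lam mu)%E
    = (obj - 2^-1 * sqnorm M yd + inner (M *m mu) w
       - (2^-1 * sqnorm M (y - (yd - q))
          + alpha / 2 * sqnorm M (u + alpha^-1 *: (lam + mu - p)))
       + (inner lam (M *m v) - beta * norm1 (M *m v)))%:E.
  move=> boxw; rewrite /lagrangian indicator_in // adde0 -EFinD -EFinN.
  rewrite lagrangian_squares ?gt_eqF //; congr EFin.
  by rewrite -/q /obj; ring.
pose ystar := yd - q; pose ustar := - (alpha^-1 *: (lam + mu - p)).
(* At the minimizers in y and u the squares vanish; z = M v is arbitrary. *)
have bestE z w : box a b w ->
    S (obj - 2^-1 * sqnorm M yd + inner (M *m mu) w
       + (inner lam z - beta * norm1 z))%:E.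
  move=> boxw; exists (lagrangian alpha beta a b M K yd yr
    ystar ustar (invmx M *m z) w p lam mu).
    by exists ystar, ustar, (invmx M *m z), w.
  rewrite valE // mulKVmx // subrr addNr.
  have -> : sqnorm M 0 = 0 by rewrite sqnormE mulmx0 inner0r.
  by rewrite !mulr0 addr0 subr0.
have [boxlam|nboxlam] := pselect (box (- beta) beta lam); last first.
  (* Outside the box, v = t M^-1 z with w = 0 sends the value to +oo. *)
  have [z zlt] := inner_gt_norm1 nboxlam.
  rewrite (indicator_notin nboxlam) addey // addye; last first.
    by rewrite gt_eqF // (lt_le_trans _ (support_fun_ge0 _ box0)) ?ltNyr.
  rewrite addye //.
  apply: (@ereal_sup_ray _ _ (obj - 2^-1 * sqnorm M yd)
           (inner lam z - beta * norm1 z)); first by rewrite subr_gt0.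
  move=> t t0; have := bestE (t *: z) 0 box0.
  rewrite inner0r addr0 innerZr norm1Z ger0_norm //.
  by rewrite mulrBr (mulrCA beta).
rewrite (indicator_in boxlam) adde0 [X in _ = X]addeAC -EFinB.
apply/eqP; rewrite eq_le; apply/andP; split.
  apply: ge_ereal_sup => _ [_ [y [u [v [w ->]]]] <-].
  have [boxw|nboxw] := pselect (box a b w); last first.
    by rewrite /lagrangian (indicator_notin nboxw) addey // addye // leNye.
  rewrite valE //.
  apply: (@le_trans _ _ (obj - 2^-1 * sqnorm M yd + inner (M *m mu) w)%:E).
    rewrite lee_fin.
    have := sqnorm_ge0 (y - (yd - q)) M_spd.
    have /(mulr_ge0 (ltW alpha0)) :=
      sqnorm_ge0 (u + alpha^-1 *: (lam + mu - p)) M_spd.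
    have := inner_le_norm1 (M *m v) boxlam.
    lra.
  by rewrite [leLHS]EFinD leeD2l //; apply: ereal_sup_ubound; exists w.
rewrite addeC -leeBrDr //; apply: ge_ereal_sup => _ [w boxw <-].
rewrite leeBrDr // -EFinD addrC.
(* Inside the box, v = 0 is optimal. *)
have := bestE 0 w boxw.
rewrite inner0r -(scale0r (0 : 'cV[R]_N)) norm1Z normr0 mul0r mulr0 subrr addr0.
exact: ereal_sup_ubound.
Qed.

Theorem theorem6 (R : realType) (N : nat) (alpha beta a b : R)
    (M K : 'M[R]_N) (yd yr : 'cV[R]_N)
    (alpha_gt0 : 0 < alpha) (beta_gt0 : 0 < beta)
    (a_le0 : a <= 0) (b_ge0 : 0 <= b)
    (M_spd : spd M) (K_spd : spd K) :
  [/\ (* the split problem is the primal problem with copies v, w of u *)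
      forall y u : 'cV[R]_N,
        split_obj alpha beta a b M K yd yr y u u u
          = primal_obj alpha beta a b M K yd yr y u,
      (* the primal side of the Lagrangian is the split problem *)
      forall y u v w : 'cV[R]_N,
        ereal_sup [set l | exists p lam mu : 'cV[R]_N,
          l = lagrangian alpha beta a b M K yd yr y u v w p lam mu]
        = split_obj alpha beta a b M K yd yr y u v w
    & (* the minimization form of the Lagrangian dual problem is (D_h) *)
      forall lam p mu : 'cV[R]_N,
        (- dual_fun alpha beta a b M K yd yr p lam mu)%E
          = Phi alpha beta a b M K yd yr lam p mu].
Proof.
split=> [y u|y u v w|lam p mu].
- rewrite /split_obj /primal_obj.
  have [boxu|nboxu] := pselect (box a b u); last first.
    by rewrite (indicator_notin nboxu) addey // if_same asboolF // => -[].
  rewrite (indicator_in boxu) adde0.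
  by congr (if _ then _ else _); apply: asbool_equiv_eq; split=> [[]|[]].
- exact: ereal_sup_lagrangian.
- exact: dual_fun_conjugate K_spd.1.
Qed.
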